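(* For all Noetherian spaces $X$ and $Y$, $\mathrm{sob}(X+Y) = \max(\mathrm{sob}\, X, \mathrm{sob}\, Y)$ and $\mathrm{rsob}(X+Y) = \max(\mathrm{rsob}\, X, \mathrm{rsob}\, Y)$.
   Context: A topological space is Noetherian if every open subset is compact (every open cover has a finite subcover; no separation is required). $X+Y$ denotes the topological sum (coproduct, i.e. disjoint union) of $X$ and $Y$; it is Noetherian when $X$ and $Y$ are. For a well-founded poset $P$ and $x \in P$, $\mathrm{rk}_P(x) = \sup_{x' < x} (\mathrm{rk}_P(x')+1)$ and the ordinal rank of $P$ is $|P| = \sup_{x \in P} (\mathrm{rk}_P(x)+1)$, where $\sup\emptyset = 0$. A closed subset $C$ of $X$ is irreducible if it is non-empty and, whenever $C \subseteq F_1 \cup F_2$ with $F_1, F_2$ closed in $X$, we have $C \subseteq F_1$ or $C \subseteq F_2$. $\mathcal{S} X$ is the poset of irreducible closed subsets of $X$, ordered by inclusion (well-founded when $X$ is Noetherian). The sobrification rank of a Noetherian space $X$ is $\mathrm{sob}\, X = |\mathcal{S} X|$. When $X$ is non-empty, $\mathrm{sob}\, X$ is a successor ordinal. The reduced sobrification rank is $\mathrm{rsob}\, X = \mathrm{sob}\, X - 1$, where $\alpha - 1$ is the ordinal whose successor is $\alpha$ if $\alpha$ is a successor ordinal, and $0 - 1 = 0$ by convention (so the reduced sobrification rank of the empty space is $0$). *)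

(* Defs.v *)
From HB Require Import structures.
From mathcomp Require Import all_boot all_order finmap.
From mathcomp Require Import all_classical topology.

Set Implicit Arguments.
Unset Strict Implicit.
Unset Printing Implicit Defensive.

Local Open Scope classical_set_scope.

(** Ordinals.  A well-founded tree [Tree f] denotes the least ordinal strictly
    above all the ordinals denoted by the [f i].  Every ordinal is denoted by
    some tree, and [Ord] is the type of trees up to denoting the same ordinal
    (equivalence classes, so that equality of ordinals is Leibniz equality).
    [Ord] is deliberately not a [choiceType]/[orderType]: that would force its
    universe below the one of [topologicalType], and ordinals would then be
    too small to be the ranks of arbitrary topological spaces. *)

Inductive tree : Type := Tree (I : Type) (f : I -> tree).

Fixpoint tree_le (s t : tree) : Prop :=
  let: Tree A f := s in let: Tree B g := t in
  forall i, exists j, tree_le (f i) (g j).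

Lemma tree_le_refl t : tree_le t t.
Proof. by elim: t => I f IH i; exists i; exact: IH. Qed.

Lemma tree_le_trans s t u : tree_le s t -> tree_le t u -> tree_le s u.
Proof.
elim: s t u => I f IH [J g] [K h] fg gh i.
have [j fij] := fg i; have [k gjk] := gh j.
by exists k; exact: IH fij gjk.
Qed.

Lemma tree_le_total s t : tree_le s t \/ tree_le t s.
Proof.
elim: s t => I f IH [J g]; have [|/existsNP[i nfi]] := pselect (tree_le (Tree f) (Tree g)).
  by left.
right=> j; exists i; have [fij|//] := IH i (g j).
by case: nfi; exists j.
Qed.

Definition tree_eq (s t : tree) : Prop := tree_le s t /\ tree_le t s.

Definition Ord : Type := {C : tree -> Prop | exists t, C = tree_eq t}.

Definition ord_of (t : tree) : Ord := exist _ (tree_eq t) (ex_intro _ t erefl).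

Definition ord_repr (a : Ord) : tree := sval (cid (svalP a)).

Lemma ord_reprK (a : Ord) : ord_of (ord_repr a) = a.
Proof.
rewrite /ord_repr; case: cid => t /=; case: a => C /= [u Cu] Ct.
by apply: eq_exist => /=.
Qed.

Lemma ord_ofP (s t : tree) : ord_of s = ord_of t <-> tree_eq s t.
Proof.
split=> [[st]|[st ts]].
  have : tree_eq t t by split; exact: tree_le_refl.
  by rewrite -st.
apply: eq_exist => /=; apply/funext => u; apply/propext.
by split=> -[? ?]; split; eauto using tree_le_trans.
Qed.

Definition ole (a b : Ord) : Prop := tree_le (ord_repr a) (ord_repr b).
Definition olt (a b : Ord) : Prop := ole a b /\ a <> b.

Lemma ole_of (s t : tree) : ole (ord_of s) (ord_of t) <-> tree_le s t.
Proof.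
have /ord_ofP[s1 s2] := ord_reprK (ord_of s).
have /ord_ofP[t1 t2] := ord_reprK (ord_of t).
by split=> h; [apply: tree_le_trans s2 (tree_le_trans h t1)
             |apply: tree_le_trans s1 (tree_le_trans h t2)].
Qed.

Lemma ole_refl a : ole a a.
Proof. exact: tree_le_refl. Qed.

Lemma ole_anti a b : ole a b -> ole b a -> a = b.
Proof. by move=> ab ba; rewrite -(ord_reprK a) -(ord_reprK b); apply/ord_ofP. Qed.

Lemma ole_trans a b c : ole a b -> ole b c -> ole a c.
Proof. exact: tree_le_trans. Qed.

Lemma ole_total a b : ole a b \/ ole b a.
Proof. exact: tree_le_total. Qed.

Lemma oltNge a b : olt a b <-> ~ ole b a.
Proof.
split=> [[ab nab] /(ole_anti ab)//|nba].
by have [ab|//] := ole_total a b; split=> // E; apply: nba; rewrite E; exact: ole_refl.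
Qed.

Definition tree_idx (t : tree) : Type := let: Tree A _ := t in A.
Definition tree_child (t : tree) : tree_idx t -> tree :=
  let: Tree _ f := t in f.

Definition tree_sup (I : Type) (f : I -> tree) : tree :=
  Tree (fun p : {i : I & tree_idx (f i)} => tree_child (tagged p)).

Definition ozero : Ord := ord_of (Tree (fun e : void => match e with end)).
Definition osucc (a : Ord) : Ord := ord_of (Tree (fun _ : unit => ord_repr a)).
Definition osup (I : Type) (f : I -> Ord) : Ord :=
  ord_of (tree_sup (fun i => ord_repr (f i))).

Lemma tree_leP (s t : tree) :
  tree_le s t <->
  forall i : tree_idx s, exists j : tree_idx t,
    tree_le (tree_child i) (tree_child j).
Proof. by case: s => A f; case: t => B g. Qed.

Lemma tree_child_lt (t : tree) (i : tree_idx t) : ~ tree_le t (tree_child i).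
Proof.
elim: t i => J g IH i h; have [k gik] := (tree_leP _ _).1 h i.
exact: IH gik.
Qed.

Lemma tree_ltP (s t : tree) :
  ~ tree_le t s <-> exists i : tree_idx t, tree_le s (tree_child i).
Proof.
split=> [|[i si] ts]; last exact: tree_child_lt (tree_le_trans ts si).
elim: s t => I f IH t.
move=> nts; have /existsNP[j nj] : ~ forall j : tree_idx t,
    exists i : tree_idx (Tree f), tree_le (tree_child j) (tree_child i).
  by move/tree_leP.
exists j; apply/tree_leP => i; apply/IH => ji.
by apply: nj; exists i.
Qed.

Lemma ole0 (a : Ord) : ole ozero a.
Proof. by rewrite -(ord_reprK a); apply/ole_of/tree_leP => -[]. Qed.

Lemma osucc_le (a b : Ord) : ole (osucc a) b <-> olt a b.
Proof.
rewrite oltNge -{1}(ord_reprK b) ole_of tree_ltP.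
split=> [h|h]; first exact: ((tree_leP _ _).1 h tt).
by apply/tree_leP => -[].
Qed.

Lemma osup_le (I : Type) (f : I -> Ord) (a : Ord) :
  ole (osup f) a <-> forall i, ole (f i) a.
Proof.
rewrite -{1}(ord_reprK a) ole_of; split=> h.
  by move=> i; apply/tree_leP => k; exact: ((tree_leP _ _).1 h (existT _ i k)).
by apply/tree_leP => -[i k]; exact: ((tree_leP _ _).1 (h i) k).
Qed.

Lemma olt_wf : well_founded olt.
Proof.
suff H t (a : Ord) : tree_le (ord_repr a) t -> Acc olt a.
  by move=> a; exact: H (tree_le_refl _).
elim: t a => I f IH a aI; constructor=> b /oltNge/tree_ltP[k bk].
have [i ki] := (tree_leP _ _).1 aI k.
exact: IH (tree_le_trans bk ki).
Qed.

Definition omax (a b : Ord) : Ord := if pselect (ole a b) then b else a.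

Lemma omax_le (a b c : Ord) : ole (omax a b) c <-> ole a c /\ ole b c.
Proof.
rewrite /omax; case: pselect => [ab|nab]; split=> [h|[]//].
  by split=> //; exact: ole_trans ab h.
by split=> //; have [ba _] := (oltNge _ _).2 nab; exact: ole_trans ba h.
Qed.

(** [a - 1].  Nonzero limit ordinals have no predecessor and also get 0. *)
Definition opred (a : Ord) : Ord :=
  if pselect (exists b, osucc b = a) is left h then sval (cid h) else ozero.

Lemma osucc_inj : injective osucc.
Proof.
have H a b : osucc a = osucc b -> ole a b.
  move=> ab; apply: contrapT => /oltNge/osucc_le; rewrite -ab.
  by case/osucc_le/oltNge; exact: ole_refl.
by move=> a b ab; apply: ole_anti; exact: H.
Qed.

Lemma osuccK : cancel osucc opred.
Proof.
move=> a; rewrite /opred; case: pselect => [h|[]]; last by exists a.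
by case: cid => b /= /osucc_inj.
Qed.

Lemma opred0 : opred ozero = ozero.
Proof.
rewrite /opred; case: pselect => // -[b b0]; exfalso.
have /osucc_le/oltNge : ole (osucc b) ozero by rewrite b0; exact: ole_refl.
by apply; exact: ole0.
Qed.

Section Rank.
Context (P : Type) (lt : P -> P -> Prop) (wfP : well_founded lt).

Definition rk : P -> Ord :=
  Fix wfP (fun=> Ord)
    (fun x rec => osup (fun y : {y : P | lt y x} => osucc (rec (sval y) (svalP y)))).

Lemma rkE x : rk x = osup (fun y : {y : P | lt y x} => osucc (rk (sval y))).
Proof.
rewrite /rk Fix_eq// => y f g fg; congr osup.
by apply/funext => z; rewrite fg.
Qed.

Definition ordinal_rank : Ord := osup (fun x : P => osucc (rk x)).

End Rank.

Definition irreducible_closed (X : topologicalType) (C : set X) : Prop :=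
  [/\ closed C, C !=set0 &
    forall F1 F2 : set X, closed F1 -> closed F2 ->
      C `<=` F1 `|` F2 -> C `<=` F1 \/ C `<=` F2].

HB.mixin Record isNoetherian X of Topological X := {
  open_cover_compact : forall U : set X, open U -> cover_compact U
}.

#[short(type="noetherianType")]
HB.structure Definition Noetherian := {X of Topological X & isNoetherian X}.

Definition irr_closed (X : topologicalType) : Type :=
  {C : set X | irreducible_closed C}.

Definition irr_closed_lt (X : topologicalType) (C D : irr_closed X) : Prop :=
  sval C `<` sval D.

Lemma irr_closed_wf (X : noetherianType) : well_founded (@irr_closed_lt X).
Proof.
move=> C0; apply: contrapT => nC0.
have next (C : {C | ~ Acc (@irr_closed_lt X) C}) : {D : {C | ~ Acc (@irr_closed_lt X) C} | irr_closed_lt (sval D) (sval C)}.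
  apply: cid; case: C => C nC /=; apply: contrapT => h; apply: nC.
  constructor=> D DC; apply: contrapT => nD.
  by apply: h; exists (exist _ D nD).
pose c n := iter n (fun C => sval (next C)) (exist _ C0 nC0).
pose K n : set X := sval (sval (c n)).
have Klt n : K n.+1 `<` K n.
  by exact: (svalP (next (c n))).
have Kle m n : (m <= n)%N -> K n `<=` K m.
  elim: n => [|n IH]; first by rewrite leqn0 => /eqP ->.
  rewrite leq_eqVlt => /orP[/eqP->//|/IH]; apply: subset_trans.
  by have [] := Klt n.
have oK n : open (~` K n).
  by rewrite openC; have [] := svalP (sval (c n)).
have oW : open (\bigcup_n ~` K n) by exact: bigcup_open.
have [D _ WD] := 
  open_cover_compact _ oW nat setT (fun n => ~` K n) (fun n _ => oK n) (fun _ h => h).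
pose N := \max_(n <- D) n.
have /existsNP[x /not_implyP[KNx nx]] : ~ K N `<=` K N.+1 by have [] := Klt N.
have [n /= nD] : cover [set` D] (fun n => ~` K n) x.
  by apply: WD; exists N.+1.
by apply; apply: Kle KNx; exact: leq_bigmax_seq.
Qed.

Definition sob (X : noetherianType) : Ord := ordinal_rank (@irr_closed_wf X).

Definition rsob (X : noetherianType) : Ord := opred (sob X).

Section SumTopology.
Context (X Y : topologicalType).

Definition sum_open : set (set (X + Y)%type) :=
  [set U | open (inl @^-1` U) /\ open (inr @^-1` U)].

Lemma sum_openT : sum_open setT.
Proof. by split; rewrite preimage_setT; exact: openT. Qed.

Lemma sum_openI : setI_closed sum_open.
Proof. by move=> U V [? ?] [? ?]; split; rewrite preimage_setI; exact: openI. Qed.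

Lemma sum_open_bigU (I : Type) (f : I -> set (X + Y)%type) :
  (forall i, sum_open (f i)) -> sum_open (\bigcup_i f i).
Proof.
by move=> fo; split; rewrite preimage_bigcup; apply: bigcup_open => i _;
  have [] := fo i.
Qed.

HB.instance Definition _ := isOpenTopological.Build (X + Y)%type
  sum_openT sum_openI sum_open_bigU.

Lemma sum_openE (U : set (X + Y)%type) :
  open U = (open (inl @^-1` U) /\ open (inr @^-1` U)).
Proof. by []. Qed.

End SumTopology.

Section SumNoetherian.
Context (X Y : noetherianType).

Lemma sum_cover_compact (U : set (X + Y)%type) : open U -> cover_compact U.
Proof.
rewrite sum_openE => -[oUl oUr] I D f fo Uf.
have [Dl Dls Ul] : finite_subset_cover D (fun i => inl @^-1` f i) (inl @^-1` U).
  apply: open_cover_compact oUl _ _ _ _ _ => [i /fo[]//|x /Uf[i Di fi]].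
  by exists i.
have [Dr Drs Ur] : finite_subset_cover D (fun i => inr @^-1` f i) (inr @^-1` U).
  apply: open_cover_compact oUr _ _ _ _ _ => [i /fo[]//|x /Uf[i Di fi]].
  by exists i.
exists (Dl `|` Dr)%fset; first by move=> i; rewrite inE => /orP[/Dls|/Drs].
case=> [x /Ul|y /Ur] [i /= iD fi]; exists i => //=; rewrite inE iD ?orbT//.
Qed.

HB.instance Definition _ := isNoetherian.Build (X + Y)%type sum_cover_compact.

End SumNoetherian.

(* Main.v *)
Require Import Defs.
From mathcomp Require Import all_boot.
From mathcomp Require Import finmap all_classical topology.

Set Implicit Arguments.
Unset Strict Implicit.
Unset Printing Implicit Defensive.

Local Open Scope classical_set_scope.

(** Both closed summands embed in [X + Y] as closed subspaces, so the
    irreducible closed subsets of [X] and of [Y] become irreducible closed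
    subsets of [X + Y].  Nothing below such an image is new, because a closed
    subset of the image of [X] is itself an image; ranks are therefore
    preserved ([rk_closed_embedding]).  Conversely an irreducible closed subset
    of [X + Y] is covered by the two closed summands, hence lies in one of
    them.  Taking suprema gives the formula for [sob]
    ([sob_closed_embedding_cover]).

    The formula for [rsob] follows by ordinal arithmetic once each [sob] is
    known to be zero or a successor ([sob_zero_or_succ]), since [opred] does
    not commute with maxima in the presence of limit ordinals.  That
    dichotomy comes from Noetherian induction: for every closed set, either
    there is no irreducible closed subset inside it, or one of them has the
    largest rank ([irr_closed_max_rank]); inside the whole space, the successor
    of that largest rank is the supremum that defines [sob]. *)

(** * Ordinals *)

Lemma ole_osucc (a b : Ord) : ole (osucc a) (osucc b) <-> ole a b.
Proof.
rewrite osucc_le oltNge osucc_le oltNge.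
by split=> [/contrapT|ab].
Qed.

Lemma omax_idPr (a b : Ord) : ole a b -> omax a b = b.
Proof. by rewrite /omax; case: pselect. Qed.

Lemma omax_idPl (a b : Ord) : ole b a -> omax a b = a.
Proof. by rewrite /omax; case: pselect => // ab ba; exact: ole_anti. Qed.

Lemma omax_osucc (a b : Ord) :
  omax (osucc a) (osucc b) = osucc (omax a b).
Proof.
have [ab|ba] := ole_total a b.
  by rewrite !omax_idPr//; exact/ole_osucc.
by rewrite !omax_idPl//; exact/ole_osucc.
Qed.

(** Limit ordinals have to be excluded: [opred (omax 2 omega)] is [0], while
    [omax (opred 2) (opred omega)] is [1]. *)
Lemma opred_omax (a b : Ord) :
    a = ozero \/ (exists a', a = osucc a') ->
    b = ozero \/ (exists b', b = osucc b') ->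
  opred (omax a b) = omax (opred a) (opred b).
Proof.
move=> [->|[a' ->]]; first by rewrite opred0 !omax_idPr//; exact: ole0.
move=> [->|[b' ->]]; first by rewrite opred0 !omax_idPl//; exact: ole0.
by rewrite omax_osucc !osuccK.
Qed.

(** * Ranks in well-founded relations *)

(** A simulation lifts descending sequences from [x] to descending sequences
    from [y], so the rank cannot decrease along it.  A relation is used rather
    than a function so that the same lemma compares ranks in both directions
    along an embedding and gives monotonicity. *)
Lemma rk_simulation (P Q : Type) (ltP : P -> P -> Prop) (ltQ : Q -> Q -> Prop)
    (wfP : well_founded ltP) (wfQ : well_founded ltQ) (R : P -> Q -> Prop) :
    (forall x y x', R x y -> ltP x' x -> exists2 y', ltQ y' y & R x' y') ->
  forall x y, R x y -> ole (rk wfP x) (rk wfQ y).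
Proof.
move=> simR; elim/(well_founded_ind wfP) => x IH y Rxy.
rewrite (rkE wfP) (rkE wfQ); apply/osup_le => -[x' /= x'x].
have [y' y'y Rxy'] := simR _ _ _ Rxy x'x.
apply: (@ole_trans _ (osucc (rk wfQ y'))); first exact/ole_osucc/IH.
by have /osup_le/(_ (exist _ y' y'y)) := ole_refl
  (osup (fun z : {z : Q | ltQ z y} => osucc (rk wfQ (sval z)))).
Qed.

Lemma rk_lt_ordinal_rank (P : Type) (lt : P -> P -> Prop)
    (wfP : well_founded lt) (x : P) :
  ole (osucc (rk wfP x)) (ordinal_rank wfP).
Proof. by move: x; apply/osup_le; exact: ole_refl. Qed.

Lemma ordinal_rank_max (P : Type) (lt : P -> P -> Prop)
    (wfP : well_founded lt) (m : P) :
    (forall x, ole (rk wfP x) (rk wfP m)) ->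
  ordinal_rank wfP = osucc (rk wfP m).
Proof.
move=> mmax; apply: ole_anti; last exact: rk_lt_ordinal_rank.
by apply/osup_le => x; exact/ole_osucc.
Qed.

Lemma ordinal_rank_empty (P : Type) (lt : P -> P -> Prop)
    (wfP : well_founded lt) : ~ inhabited P -> ordinal_rank wfP = ozero.
Proof.
move=> P0; apply: ole_anti; last exact: ole0.
by apply/osup_le => x; case: P0.
Qed.

(** * Irreducible closed subsets of a Noetherian space *)

(** The union of the complements is compact, so finitely many of them already
    cover it. *)
Lemma closed_chain_stationary (X : noetherianType) (K : nat -> set X) :
    (forall n, closed (K n)) -> (forall n, K n.+1 `<=` K n) ->
  exists n, K n `<=` K n.+1.
Proof.
move=> clK decK.
have Kle m n : (m <= n)%N -> K n `<=` K m.
  elim: n => [|n IH]; first by rewrite leqn0 => /eqP ->.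
  by rewrite leq_eqVlt => /orP[/eqP->//|/IH]; exact: subset_trans.
have oK n : open (~` K n) by rewrite openC.
have oW : open (\bigcup_n ~` K n) by exact: bigcup_open.
have [D _ WD] := open_cover_compact _ oW nat setT (fun n => ~` K n)
  (fun n _ => oK n) (fun _ h => h).
exists (\max_(n <- D) n) => x KNx; apply: contrapT => nx.
have [n /= nD] : cover [set` D] (fun n => ~` K n) x.
  by apply: WD; exists (\max_(n <- D) n).+1.
by apply; apply: Kle KNx; exact: leq_bigmax_seq.
Qed.

(** With closedness inside the relation, a set that is not closed has no
    predecessor, so the relation is well-founded on all of [set X]. *)
Lemma closed_proper_wf (X : noetherianType) :
  well_founded (fun G F : set X => [/\ closed G, closed F & G `<` F]).
Proof.
set lt := (fun G F => _); move=> F0; apply: contrapT => nF0.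
have next (F : {F | ~ Acc lt F}) : {G : {G | ~ Acc lt G} | lt (sval G) (sval F)}.
  apply: cid; case: F => F nF /=; apply: contrapT => h; apply: nF.
  by constructor=> G GF; apply: contrapT => nG; apply: h; exists (exist _ G nG).
pose c n := iter n (fun F => sval (next F)) (exist _ F0 nF0).
have cS n : lt (sval (c n.+1)) (sval (c n)) by exact: svalP (next (c n)).
have [n] : exists n, sval (c n) `<=` sval (c n.+1).
  by apply: closed_chain_stationary => n; have [_ ? []] := cS n.
by have [_ _ []] := cS n.
Qed.

Lemma rk_irr_closed_le (X : noetherianType) (C D : irr_closed X) :
    sval C `<=` sval D ->
  ole (rk (@irr_closed_wf X) C) (rk (@irr_closed_wf X) D).
Proof.
apply: (rk_simulation _ _ (R := fun C D : irr_closed X => sval C `<=` sval D)).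
move=> {}C {}D C' CD [C'C nCC']; exists C' => //.
by split; [exact: subset_trans CD|move=> DC'; apply: nCC'; exact: subset_trans DC'].
Qed.

(** Noetherian induction: if [F] is neither empty nor irreducible, it is
    covered by two smaller closed sets, and an irreducible subset of [F] lies
    in one of the two.  This replaces the decomposition of [F] into finitely
    many irreducible components, of which only the largest rank is needed. *)
Lemma irr_closed_max_rank (X : noetherianType) (F : set X) : closed F ->
  (forall C : irr_closed X, ~ sval C `<=` F) \/
  exists2 M : irr_closed X, sval M `<=` F &
    forall C : irr_closed X, sval C `<=` F ->
      ole (rk (@irr_closed_wf X) C) (rk (@irr_closed_wf X) M).
Proof.
elim/(well_founded_ind (@closed_proper_wf X)): F => F IH clF.
have [->|F0] := eqVneq F set0.
  by left=> -[C [/= _ [x Cx] _]] /(_ x Cx).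
have [irrF|nirrF] := pselect (irreducible_closed F).
  by right; exists (exist _ F irrF) => // C CF; exact: rk_irr_closed_le.
have [F1 [F2 [clF1 clF2 F12 nF1 nF2]]] : exists F1 F2 : set X,
    [/\ closed F1, closed F2, F `<=` F1 `|` F2, ~ F `<=` F1 & ~ F `<=` F2].
  apply: contrapT => h; apply: nirrF; split => //; first exact/set0P.
  move=> F1 F2 clF1 clF2 F12; apply: contrapT => /not_orP[nF1 nF2].
  by apply: h; exists F1, F2.
have meet_lt G : ~ F `<=` G -> F `&` G `<` F.
  by move=> nFG; split; [exact: subIsetl|move=> FG; apply: nFG => x /FG[]].
have split_irr (C : irr_closed X) :
    sval C `<=` F -> sval C `<=` F `&` F1 \/ sval C `<=` F `&` F2.
  move=> CF; have [_ _ /(_ F1 F2 clF1 clF2)] := svalP C.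
  move=> /(_ (subset_trans CF F12)) [C1|C2]; [left|right] => x Cx.
    by split; [exact: CF|exact: C1].
  by split; [exact: CF|exact: C2].
have cl1 : closed (F `&` F1) by exact: closedI.
have cl2 : closed (F `&` F2) by exact: closedI.
have [no1|[M1 M1F max1]] := IH (F `&` F1) (And3 cl1 clF (meet_lt _ nF1)) cl1;
  have [no2|[M2 M2F max2]] := IH (F `&` F2) (And3 cl2 clF (meet_lt _ nF2)) cl2.
- by left=> C /split_irr[/no1|/no2].
- by right; exists M2 => [x /M2F[]//|C /split_irr[/no1|/max2]].
- by right; exists M1 => [x /M1F[]//|C /split_irr[/max1|/no2]].
- right; have [M12|M21] := ole_total (rk (@irr_closed_wf X) M1)
                                     (rk (@irr_closed_wf X) M2).
  + exists M2 => [x /M2F[]//|C /split_irr[/max1|/max2]//].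
    by move/ole_trans; apply.
  + exists M1 => [x /M1F[]//|C /split_irr[/max1|/max2]//].
    by move/ole_trans; apply.
Qed.

Lemma sob_zero_or_succ (X : noetherianType) :
  sob X = ozero \/ exists a, sob X = osucc a.
Proof.
have [no|[M _ Mmax]] := irr_closed_max_rank (@closedT X).
  by left; apply: ordinal_rank_empty => -[C]; exact: (no C).
by right; exists (rk (@irr_closed_wf X) M); apply: ordinal_rank_max => C; exact: Mmax.
Qed.

(** * Closed embeddings *)

(** The second clause is continuity, phrased with closed sets because only
    those are ever pulled back. *)
Definition closed_embedding (X Z : topologicalType) (i : X -> Z) : Prop :=
  [/\ injective i, forall F, closed F -> closed (i @^-1` F) &
      forall F, closed F -> closed (i @` F)].

Section ClosedEmbedding.
Context (X Z : topologicalType) (i : X -> Z) (emb : closed_embedding i).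

Lemma irreducible_closed_image (C : set X) :
  irreducible_closed C -> irreducible_closed (i @` C).
Proof.
have [_ i_pre i_img] := emb.
move=> [clC [x Cx] irrC]; split; [exact: i_img|by exists (i x), x|].
move=> F1 F2 /i_pre cl1 /i_pre cl2; rewrite !image_sub => C12.
exact: irrC.
Qed.

Lemma irreducible_closed_preimage (D : set Z) :
  D `<=` range i -> irreducible_closed D -> irreducible_closed (i @^-1` D).
Proof.
have [i_inj i_pre i_img] := emb.
move=> Di [clD [z Dz] irrD]; split; first exact: i_pre.
  by have [x _ xz] := Di z Dz; exists x; rewrite /preimage /= xz.
move=> F1 F2 /i_img cl1 /i_img cl2 D12.
have down F : D `<=` i @` F -> i @^-1` D `<=` F.
  by move=> DF x /DF[y Fy /i_inj <-].
have D12i : D `<=` i @` F1 `|` i @` F2.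
  rewrite -image_setU => y Dy; have [x _ xy] := Di y Dy.
  by exists x => //; apply: D12; rewrite /preimage /= xy.
by have [D1|D2] := irrD _ _ cl1 cl2 D12i; [left|right]; exact: down.
Qed.

Definition irr_closed_image (C : irr_closed X) : irr_closed Z :=
  exist _ _ (irreducible_closed_image (svalP C)).

Lemma irr_closed_imageP (D : irr_closed Z) :
  sval D `<=` range i -> exists C, D = irr_closed_image C.
Proof.
move=> Di; exists (exist _ _ (irreducible_closed_preimage Di (svalP D))).
case: D Di => D irrD /= Di; apply: eq_exist => /=.
apply/seteqP; split=> [z Dz|]; last exact: image_preimage_subset.
by have [x _ xz] := Di z Dz; exists x => //=; rewrite xz.
Qed.

Lemma irr_closed_image_lt (C D : irr_closed X) :
  irr_closed_lt (irr_closed_image C) (irr_closed_image D) <-> irr_closed_lt C D.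
Proof.
have [i_inj _ _] := emb.
have sub (A B : set X) : i @` A `<=` i @` B <-> A `<=` B.
  split=> [AB x Ax|AB]; last exact: image_subset.
  by have [y By /i_inj <-] := AB (i x) (ex_intro2 _ _ x Ax erefl).
by rewrite /irr_closed_lt /= /proper !sub.
Qed.

End ClosedEmbedding.

(** The images of irreducible closed sets form an initial segment of the
    irreducible closed sets of [Z], on which the rank is computed as in [X]. *)
Lemma rk_closed_embedding (X Z : noetherianType) (i : X -> Z)
    (emb : closed_embedding i) (C : irr_closed X) :
  rk (@irr_closed_wf Z) (irr_closed_image emb C) = rk (@irr_closed_wf X) C.
Proof.
apply: ole_anti.
  apply: (rk_simulation _ _ (R := fun D C => D = irr_closed_image emb C)) => //.
  move=> _ {}C D' -> D'C.
  have [C' E] : exists C', D' = irr_closed_image emb C'.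
    by apply: irr_closed_imageP => z /(proj1 D'C)[x _ <-]; exists x.
  by exists C' => //; apply/(irr_closed_image_lt emb); rewrite -E.
apply: (rk_simulation _ _ (R := fun C D => D = irr_closed_image emb C)) => //.
move=> {}C _ C' -> C'C; exists (irr_closed_image emb C') => //.
exact/irr_closed_image_lt.
Qed.

Lemma sob_closed_embedding_le (X Z : noetherianType) (i : X -> Z) :
  closed_embedding i -> ole (sob X) (sob Z).
Proof.
move=> emb; apply/osup_le => C; rewrite -(rk_closed_embedding emb).
exact: rk_lt_ordinal_rank.
Qed.

(** An irreducible closed set covered by the two closed ranges lies in one of
    them; the ranges may overlap. *)
Lemma sob_closed_embedding_cover (X Y Z : noetherianType)
    (i : X -> Z) (j : Y -> Z) :
    closed_embedding i -> closed_embedding j -> range i `|` range j = setT ->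
  sob Z = omax (sob X) (sob Y).
Proof.
move=> ei ej cov; apply: ole_anti; last first.
  by apply/omax_le; split; [exact: sob_closed_embedding_le ei
                           |exact: sob_closed_embedding_le ej].
have [omaxX omaxY] := (omax_le _ _ _).1 (ole_refl (omax (sob X) (sob Y))).
apply/osup_le => D.
have [_ _ img_i] := ei; have [_ _ img_j] := ej.
have [_ _ irrD] := svalP D.
have [|Di|Dj] := irrD _ _ (img_i _ closedT) (img_j _ closedT).
- by rewrite cov.
- have [C ->] := irr_closed_imageP ei Di; rewrite rk_closed_embedding.
  exact: ole_trans (rk_lt_ordinal_rank _ _) omaxX.
- have [C ->] := irr_closed_imageP ej Dj; rewrite rk_closed_embedding.
  exact: ole_trans (rk_lt_ordinal_rank _ _) omaxY.
Qed.

(** * Topological sums *)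

Lemma sum_closedE (X Y : topologicalType) (F : set (X + Y)%type) :
  closed F <-> closed (inl @^-1` F) /\ closed (inr @^-1` F).
Proof. by rewrite -(openC F) -(openC (inl @^-1` F)) -(openC (inr @^-1` F)). Qed.

Lemma closed_embedding_inl (X Y : topologicalType) :
  closed_embedding (inl : X -> (X + Y)%type).
Proof.
split=> [x y []//|F /sum_closedE[]//|F clF]; apply/sum_closedE; split.
  rewrite (_ : _ @^-1` _ = F)//.
  by apply/seteqP; split=> [x [y Fy [<-]]//|x Fx]; exists x.
rewrite (_ : _ @^-1` _ = set0); first exact: closed0.
by apply/seteqP; split=> x [].
Qed.

Lemma closed_embedding_inr (X Y : topologicalType) :
  closed_embedding (inr : Y -> (X + Y)%type).
Proof.
split=> [x y []//|F /sum_closedE[]//|F clF]; apply/sum_closedE; split.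
  rewrite (_ : _ @^-1` _ = set0); first exact: closed0.
  by apply/seteqP; split=> x [].
rewrite (_ : _ @^-1` _ = F)//.
by apply/seteqP; split=> [x [y Fy [<-]]//|x Fx]; exists x.
Qed.

Theorem proposition8p4 (X Y : noetherianType) :
  sob (X + Y)%type = omax (sob X) (sob Y) /\
  rsob (X + Y)%type = omax (rsob X) (rsob Y).
Proof.
have sobD : sob (X + Y)%type = omax (sob X) (sob Y).
  apply: sob_closed_embedding_cover (@closed_embedding_inl X Y)
    (@closed_embedding_inr X Y) _.
  by apply/seteqP; split=> // -[x|y] _; [left; exists x|right; exists y].
split=> //; rewrite /rsob sobD.
by apply: opred_omax; exact: sob_zero_or_succ.
Qed.
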